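(* No tournament on $8$ vertices is intrinsically $2$-linked with $1$-knotted component as a directed graph.
   Context: A tournament on $k$ vertices is a directed graph on $k$ vertices with exactly one directed edge between each pair of distinct vertices (equivalently, the complete graph $K_k$ with a choice of orientation of each edge). Embeddings are embeddings of the graph in $S^3$, in the usual (tame) sense of spatial graph theory. A cycle in a directed graph means a cycle of the underlying undirected graph; it is consistently oriented if its edges all point the same way around the cycle (i.e. it is a directed cycle). A directed graph $G$ is intrinsically $n$-linked with $m$-knotted components as a directed graph if every embedding of $G$ in $S^3$ contains $n$ pairwise disjoint, consistently oriented cycles that form a non-split $n$-component link in which at least $m$ of the components are non-trivial knots. *)

(* Defs.v *)
From mathcomp Require Import all_boot all_order all_algebra.
From mathcomp Require Import all_classical all_reals all_analysis.

Set Implicit Arguments.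
Unset Strict Implicit.
Unset Printing Implicit Defensive.

Import Order.TTheory GRing.Theory Num.Theory.
Import numFieldNormedType.Exports.

Local Open Scope classical_set_scope.
Local Open Scope ring_scope.

(** A directed graph on [V] is a relation [e : rel V]; [e u v] means that there
    is an edge from [u] to [v]. *)

Definition tournament (V : finType) (e : rel V) : Prop :=
  (forall u, ~~ e u u) /\ (forall u v, u != v -> e u v (+) e v u).

(** A consistently oriented cycle, listed in the direction of its edges.  In a
    loopless graph without antiparallel edges, such as a tournament, it has at
    least three vertices. *)
Definition dicycle (V : finType) (e : rel V) (c : seq V) : bool :=
  [&& c != [::], uniq c & path.cycle e c].

Notation S3 R := (one_point_compactification 'rV[R]_3).

Definition of_R3 {R : realType} (x : 'rV[R]_3) : S3 R := Some x.

Definition homeomorphism (T U : topologicalType) (h : T -> U) : Prop :=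
  continuous h /\
  exists g : U -> T, [/\ continuous g, cancel h g & cancel g h].

Definition ambient_isotopy (R : realType) (H : R -> S3 R -> S3 R) : Prop :=
  [/\ {within `[0, 1] `*` [set: S3 R],
         continuous (fun p : R * S3 R => H p.1 p.2)},
      forall x, H 0 x = x
    & forall t : R, 0 <= t <= 1 -> homeomorphism (H t)].

Definition ambient_isotopic (R : realType) (A B : set (S3 R)) : Prop :=
  exists2 H : R -> S3 R -> S3 R, ambient_isotopy H & H 1 @` A = B.

Definition standard_circle (R : realType) : set (S3 R) :=
  of_R3 @` [set x : 'rV[R]_3 | x 0 0 ^+ 2 + x 0 1 ^+ 2 = 1 /\ x 0 2%:R = 0].

Definition trivial_knot (R : realType) (K : set (S3 R)) : Prop :=
  ambient_isotopic K (@standard_circle R).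

Definition standard_sphere (R : realType) : set (S3 R) :=
  of_R3 @` [set x : 'rV[R]_3 | \sum_(i < 3) x 0 i ^+ 2 = 1].

(** By Alexander's theorem the tame 2-spheres in [S3] are exactly the images of
    the round one under self-homeomorphisms of [S3]. *)
Definition tame_sphere (R : realType) (S : set (S3 R)) : Prop :=
  exists2 h : S3 R -> S3 R, homeomorphism h & S = h @` @standard_sphere R.

(** The link with components [K i] is split if some 2-sphere in its complement
    has parts of the link on both sides. *)
Definition split_link (R : realType) (n : nat) (K : 'I_n -> set (S3 R)) : Prop :=
  exists S : set (S3 R), [/\ tame_sphere S, forall i, K i `&` S = set0 &
    exists i j x y,
      [/\ K i x, K j y & ~ connected_component (~` S) x y]].

Definition segment (R : realType) (a b : 'rV[R]_3) : set 'rV[R]_3 :=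
  [set (1 - t) *: a + t *: b | t in `[0, 1]].

Definition polygonal (R : realType) (A : set (S3 R)) : Prop :=
  exists s : seq ('rV[R]_3 * 'rV[R]_3),
    A = [set of_R3 x | x in [set x | exists2 ab, ab \in s & segment ab.1 ab.2 x]].

(** A set is tame if some self-homeomorphism of [S3] makes it polygonal. *)
Definition tame (R : realType) (A : set (S3 R)) : Prop :=
  exists2 h : S3 R -> S3 R, homeomorphism h & polygonal (h @` A).

(** For an edge [e u v], [edge_arc u v] is its parametrization by [0, 1]; the values
    of [edge_arc] outside the edges or outside [0, 1] are irrelevant. *)
Record spatial_embedding (R : realType) (V : finType) (e : rel V) := {
  pt : V -> S3 R;
  edge_arc : V -> V -> R -> S3 R;
  pt_inj : injective pt;
  arc_continuous : forall u v, e u v -> {within `[0, 1], continuous (edge_arc u v)};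
  arc0 : forall u v, e u v -> edge_arc u v 0 = pt u;
  arc1 : forall u v, e u v -> edge_arc u v 1 = pt v;
  arc_pt : forall u v w (t : R), e u v -> 0 < t < 1 -> edge_arc u v t <> pt w;
  arc_inj : forall u v u' v' (s t : R), e u v -> e u' v' -> 0 < s < 1 -> 0 < t < 1 ->
    edge_arc u v s = edge_arc u' v' t -> [/\ u = u', v = v' & s = t];
  embedding_tame : tame (range pt `|`
    [set edge_arc uv.1 uv.2 t | uv in [set uv : V * V | e uv.1 uv.2] & t in `[0, 1]])
}.

Definition cycle_image (R : realType) (V : finType) (e : rel V)
    (f : spatial_embedding R e) (c : seq V) : set (S3 R) :=
  [set edge_arc f x (next c x) t | x in [set` c] & t in `[0, 1]].

Definition intrinsically_linked_knotted (R : realType) (n m : nat)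
    (V : finType) (e : rel V) : Prop :=
  forall f : spatial_embedding R e,
  exists c : 'I_n -> seq V,
    [/\ forall i, dicycle e (c i),
        forall i j, i != j -> ~~ has (mem (c i)) (c j),
        ~ split_link (fun i => cycle_image f (c i))
      & exists2 A : {set 'I_n}, (m <= #|A|)%N &
          forall i, i \in A -> ~ trivial_knot (cycle_image f (c i))].

(* Main.v *)
Require Import Defs.
From Stdlib Require Import BinInt.
From mathcomp Require Import all_boot all_order all_algebra.
From mathcomp Require Import all_classical all_reals all_analysis.
From mathcomp Require Import ring lra zify ssrZ.

(* Two disjoint directed cycles of a tournament on 8 vertices have at least three
   vertices each, hence at most five.  Embed the tournament with straight edges
   and with its vertices on the moment curve.  A closed polygon with at most five
   edges and vertices in general position has an axis, a line from which every
   half-plane meets the polygon exactly once; an isotopy moving points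
   horizontally makes this axis vertical, and a second one moves points radially
   and vertically inside the half-planes onto the standard circle.  Hence no
   component of a two-component link of directed cycles is knotted. *)

Set Implicit Arguments.
Unset Strict Implicit.
Unset Printing Implicit Defensive.

Import Order.TTheory GRing.Theory Num.Theory.
Import numFieldNormedType.Exports.

Local Open Scope classical_set_scope.
Local Open Scope ring_scope.

(** * Ambient isotopies of the 3-sphere *)

(** The obstacle is that [trivial_knot] asks for an ambient isotopy of the whole of [S3], so every
    unknotting has to be written down. Both motions therefore have the form [x + t *: D x] with
    explicit inverses, and only their continuity on the axis and at infinity needs an argument. The
    axis does not come from a general-position theorem. The eight vertices are one fixed set of
    integer points, there are 1876 cyclic sequences of three to five labels, and for each of them a
    suitable line is found by testing signs of integer determinants. The test is planar: projected
    along the line, the polygon must wind once, always turning the same way, around the origin. The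
    moment curve serves the embedding: a plane meets it in at most three points, which keeps
    straight edges from crossing. *)

Lemma homeomorphism_comp (T U W : topologicalType) (h : T -> U) (k : U -> W) :
  homeomorphism h -> homeomorphism k -> homeomorphism (k \o h).
Proof.
move=> [ch [h' [ch' hK h'K]]] [ck [k' [ck' kK k'K]]]; split.
  by move=> x; apply: continuous_comp; [exact: ch | exact: ck].
exists (h' \o k'); split; [|exact: can_comp | exact: can_comp].
by move=> x; apply: continuous_comp; [exact: ck' | exact: ch'].
Qed.

Lemma compact_homeomorphism (T U : topologicalType) (h : T -> U) (g : U -> T) :
  compact [set: T] -> hausdorff_space U -> continuous h ->
  cancel h g -> cancel g h -> homeomorphism h.
Proof.
move=> cT hU ch hK gK; split=> //; exists g; split=> //.
apply/continuous_closedP => A cA.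
have -> : g @^-1` A = h @` A.
  apply/seteqP; split=> [y /= Ay|_ [x Ax <-]]; first by exists (g y).
  by rewrite /= hK.
apply: compact_closed => //; apply: continuous_compact.
  exact: continuous_subspaceT.
exact: subclosed_compact cA cT _.
Qed.

Section isotopies.
Variable R : realType.
Implicit Types (H : R -> S3 R -> S3 R) (K : set (S3 R)).
Local Notation E3 := 'rV[R]_3.

Lemma ball_compact (M : R) : compact [set x : E3 | `|x| <= M].
Proof.
apply: bounded_closed_compact.
  by exists M; split=> // [|N /ltW MN x /= /le_trans]; [exact: num_real | exact].
apply: (preimage_closed (f := fun x : E3 => `|x|) (D := [set y | y <= M])).
  by move=> x _; exact: norm_continuous.
exact: closed_le.
Qed.

Lemma S3_compact : compact [set: S3 R].
Proof. exact: one_point_compactification_compact. Qed.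

Lemma E3_locally_compact : locally_compact [set: E3].
Proof.
move=> x _; rewrite withinET; exists [set y | `|y| <= `|x| + 1]; last first.
  split; first exact: ball_compact.
  by apply: compact_closed; [exact: norm_hausdorff | exact: ball_compact].
apply/nbhs_ballP; exists 1 => //= y; rewrite mx_norm_ball /ball_ /= => xy.
have -> : y = x - (x - y) by rewrite opprB addrC subrK.
by rewrite (le_trans (ler_normB _ _)) // lerD2l ltW.
Qed.

Lemma S3_hausdorff : hausdorff_space (S3 R).
Proof.
apply: one_point_compactification_hausdorff; first exact: E3_locally_compact.
exact: norm_hausdorff.
Qed.

Lemma ambient_isotopic_refl K : ambient_isotopic K K.
Proof.
exists (fun _ => id); last by rewrite image_id.
split=> [|//|t _].
  apply/subspace_continuousP => p _.
  by apply: cvg_within_filter; exact: cvg_snd.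
split; first by move=> x; exact: cvg_id.
by exists id; split=> // x; exact: cvg_id.
Qed.

(** Composing at equal times, instead of concatenating, needs no reparametrization of [[0, 1]], and
    the time-one maps compose as well. *)
Lemma ambient_isotopy_comp H1 H2 : ambient_isotopy H1 -> ambient_isotopy H2 ->
  ambient_isotopy (fun t => H2 t \o H1 t).
Proof.
move=> [c1 id1 h1] [c2 id2 h2]; split.
- apply/subspace_continuousP => -[t x] tx.
  move/subspace_continuousP: c1 => /(_ (t, x) tx) c1.
  have tH1x : (`[0, 1] `*` [set: S3 R]) (t, H1 t x) by case: tx.
  move/subspace_continuousP: c2 => /(_ _ tH1x) c2.
  move=> U /c2 [[A B]] /= [At Bx] AB.
  have [/= [A1 B1] /= [A1t B1x] AB1] := c1 _ Bx.
  exists (A `&` A1, B1) => /=; first by split=> //; exact: filterI.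
  move=> [s y] /= [[As A1s] B1y] sy.
  apply: (AB (s, H1 s y)); last by case: sy.
  by split=> //=; apply: (AB1 (s, y)).
- by move=> x; rewrite /= id1 id2.
- by move=> t t01; apply: homeomorphism_comp; [exact: h1 | exact: h2].
Qed.

Lemma trivial_knot_isotopy H K : ambient_isotopy H ->
  trivial_knot (H 1 @` K) -> trivial_knot K.
Proof.
move=> iH [H' iH' KC]; exists (fun t => H' t \o H t).
  exact: ambient_isotopy_comp.
by rewrite -KC -image_comp.
Qed.

(** Properness uniform in [t] gives joint continuity at infinity, which stays fixed. Set-theoretic
    inverses are enough, because a continuous bijection of the compact Hausdorff space [S3] is a
    homeomorphism. *)
Lemma straight_line_isotopy (D : E3 -> E3) : continuous D ->
  (forall t, 0 <= t <= 1 -> exists2 G : E3 -> E3,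
     cancel (fun x => x + t *: D x) G & cancel G (fun x => x + t *: D x)) ->
  (forall M, exists N, forall t x, 0 <= t <= 1 ->
     `|x + t *: D x| <= M -> `|x| <= N) ->
  ambient_isotopy (fun t => omap (fun x : E3 => x + t *: D x) : S3 R -> S3 R).
Proof.
move=> cD bij proper.
pose H (t : R) : S3 R -> S3 R := omap (fun x : E3 => x + t *: D x).
rewrite -/H.
have cH : {within `[0, 1] `*` [set: S3 R],
    continuous (fun p : R * S3 R => H p.1 p.2)}.
  apply/subspace_continuousP => -[t [x|]] [/= t01 _] U /=.
  - move=> nU.
    have cF : continuous (fun p : R * E3 => p.2 + p.1 *: D p.2).
      move=> p; apply: continuousD; first exact: cvg_snd.
      apply: continuousZ; first exact: cvg_fst.
      by apply: continuous_comp; [exact: cvg_snd | exact: cD].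
    have [[A B] /= [At Bx] AB] := cF (t, x) _ nU.
    exists (A, Some @` B) => /=.
      by split=> //; exact: one_point_compactification_some_nbhs.
    move=> [s _] /= [As [y By <-]] _; exact: (AB (s, y)).
  - move=> [C [cC _] CU].
    have [M [_ /(_ (`|M| + 1)) MC]] := compact_bounded cC.
    have {}MC y : C y -> `|y| <= `|M| + 1.
      by apply: MC; rewrite ltr_pwDr // ler_norm.
    have [N FN] := proper (`|M| + 1).
    exists (setT, (Some @` ~` [set y : E3 | `|y| <= N]) `|` [set None]) => /=.
      split; first exact: filterT.
      exists [set y : E3 | `|y| <= N] => //; split; first exact: ball_compact.
      by apply: compact_closed; [exact: norm_hausdorff | exact: ball_compact].
    move=> [s [y|]] /= [_ yN] [s01 _]; apply: CU; last by right.
    left; exists (y + s *: D y) => // Cy; case: yN => // -[z zN [zy]].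
    by apply: zN; rewrite zy; apply: (FN s) => //; exact: MC.
split=> // [[x|] //|t t01]; first by rewrite /H /= scale0r addr0.
have [G FG GF] := bij t t01.
apply: (@compact_homeomorphism (S3 R) (S3 R) (H t) (omap G)).
- exact: S3_compact.
- exact: S3_hausdorff.
- move=> x U nU; move/subspace_continuousP: cH => /(_ (t, x)).
  have tA : (`[0, 1] `*` [set: S3 R]) (t, x) by split.
  move=> /(_ tA U nU) [[A B] /= [At Bx] AB].
  apply: filterS Bx => y By; apply: (AB (t, y)) => //.
  by split=> //; exact: nbhs_singleton.
- by move=> [x|] //=; rewrite FG.
- by move=> [x|] //=; rewrite GF.
Qed.

End isotopies.

(** * Knots encircling an axis *)

(** Away from a neighbourhood of [h x0], compactness of [K] makes [P x] fail everywhere at once for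
    [x] near [x0], so [h x] has no other place to go. *)
Lemma closed_graph_continuous (T U : topologicalType) (K : set U)
    (P : T -> U -> Prop) (h : T -> U) (x0 : T) :
  compact K -> (forall x, K (h x)) ->
  (\forall x \near x0, P x (h x)) ->
  (forall y, K y -> y <> h x0 -> \forall y' \near y & x \near x0, ~ P x y') ->
  h x @[x --> x0] --> h x0.
Proof.
move=> cK Kh Ph sepP N; rewrite nbhsE => -[V [oV Vh] VN].
have cKV : compact (K `&` ~` V).
  by apply: compact_closedI => //; exact: open_closedC.
have : \forall x \near x0, K `&` ~` V `<=` (fun y => ~ P x y).
  move/compact_near_coveringP: cKV; apply=> y [Ky nVy]; apply: sepP => //.
  by move=> yh; apply: nVy; rewrite yh.
apply: filter_app; apply: filter_app Ph; apply: nearW => x Pxh nP /=.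
by apply: VN; apply: contrapT => nV; apply: (nP (h x)).
Qed.

(** Serves at points of the axis, where the factor [b] may jump but stays bounded. *)
Lemma bounded_mul_continuous (R : realType) (T : topologicalType)
    (b g : T -> R) (C : R) (x0 : T) :
  (forall x, `|b x| <= C) -> {for x0, continuous g} -> g x0 = 0 ->
  {for x0, continuous (fun x => b x * g x)}.
Proof.
move=> bC cg g0; rewrite /prop_for /continuous_at g0 mulr0.
apply/cvgr0Pnorm_le => e e0.
have C0 : 0 <= C by apply: le_trans (bC x0).
have : g x @[x --> x0] --> (0 : R) by rewrite -g0.
move/cvgr0Pnorm_le => /(_ (e / (C + 1))).
have C1 : 0 < C + 1 by rewrite ltr_wpDl.
move=> /(_ (divr_gt0 e0 C1)); apply: filterS => x gx.
rewrite normrM (le_trans (ler_pM _ _ (bC x) gx)) //.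
rewrite mulrCA ler_piMr //; first exact: ltW.
by rewrite ler_pdivrMr // mul1r lerDl.
Qed.

Section coordinates.
Variable R : realType.
Implicit Types (a b c : R) (x y : 'rV[R]_3).

Definition vec3 a b c : 'rV[R]_3 := \row_j [:: a; b; c]`_j.

Lemma vec3_0 a b c : vec3 a b c 0 0 = a. Proof. by rewrite mxE. Qed.
Lemma vec3_1 a b c : vec3 a b c 0 1 = b. Proof. by rewrite mxE. Qed.
Lemma vec3_2 a b c : vec3 a b c 0 2%:R = c. Proof. by rewrite mxE. Qed.
Definition vec3E := (vec3_0, vec3_1, vec3_2).

Lemma ord3P (P : 'I_3 -> Prop) : P 0 -> P 1 -> P 2%:R -> forall j, P j.
Proof.
move=> P0 P1 P2 [[|[|[|j]]] // lj]; [move: P0|move: P1|move: P2];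
  by congr P; exact: val_inj.
Qed.

Lemma row3P x y :
  x 0 0 = y 0 0 -> x 0 1 = y 0 1 -> x 0 2%:R = y 0 2%:R -> x = y.
Proof. by move=> *; apply/rowP; apply: ord3P. Qed.

Lemma vec3_sum a b c : vec3 a b c =
  a *: vec3 1 0 0 + b *: vec3 0 1 0 + c *: vec3 0 0 1.
Proof. by apply: row3P; rewrite !(mxE, vec3E) /=; ring. Qed.

Lemma vec3_continuous (T : topologicalType) (x0 : T) (f g h : T -> R) :
  {for x0, continuous f} -> {for x0, continuous g} -> {for x0, continuous h} ->
  {for x0, continuous (fun t => vec3 (f t) (g t) (h t))}.
Proof.
move=> cf cg ch.
rewrite (_ : (fun t => _) = fun t => f t *: vec3 1 0 0 + g t *: vec3 0 1 0 +
  h t *: vec3 0 0 1); last by apply/funext => t; exact: vec3_sum.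
by apply: cvgD; [apply: cvgD|]; apply: cvgZr_tmp.
Qed.

Lemma coord_le_norm x j : `|x 0 j| <= `|x|.
Proof.
by rewrite [leRHS]/Num.Def.normr /= mx_normrE (le_bigmax _ _ (0, j)).
Qed.

Lemma norm_le_coord x M : `|x 0 0| <= M -> `|x 0 1| <= M -> `|x 0 2%:R| <= M ->
  `|x| <= M.
Proof.
move=> x0 x1 x2; rewrite [leLHS]/Num.Def.normr /= mx_normrE.
apply: bigmax_le => [|[i j] _ /=]; first exact: le_trans x0.
by rewrite ord1; move: j; apply: ord3P.
Qed.

End coordinates.

Section encircling.
Variable R : realType.
Local Notation E3 := 'rV[R]_3.

(* Each half-plane bounded by the axis [X = Y = 0] meets [K] exactly once. *)
Definition encircles (X Y : E3 -> R) (K : set E3) : Prop :=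
  [/\ forall x, K x -> ~ (X x = 0 /\ Y x = 0),
      forall a b, ~ (a = 0 /\ b = 0) ->
        exists2 x, K x & exists2 l, 0 < l & X x = l * a /\ Y x = l * b
    & forall x y l, K x -> K y -> 0 < l -> X y = l * X x -> Y y = l * Y x ->
        y = x].

Definition rad (x : E3) : R := Num.sqrt (x 0 0 ^+ 2 + x 0 1 ^+ 2).

Lemma rad_continuous : continuous rad.
Proof.
move=> x.
apply: (@continuous_comp _ _ _
  (fun x : E3 => x 0 0 * x 0 0 + x 0 1 * x 0 1) Num.sqrt).
  by apply: continuousD; apply: continuousM; exact: coord_continuous.
exact: sqrt_continuous.
Qed.

Lemma rad_scale (x y : E3) (l : R) : 0 <= l ->
  y 0 0 = l * x 0 0 -> y 0 1 = l * x 0 1 ->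
  rad y = l * rad x.
Proof.
move=> l0 y0 y1; rewrite /rad y0 y1 !exprMn -mulrDr sqrtrM ?sqr_ge0 //.
by rewrite sqrtr_sqr ger0_norm.
Qed.

Lemma rad_gt0 (x : E3) : ~ (x 0 0 = 0 /\ x 0 1 = 0) -> 0 < rad x.
Proof.
move=> x0; rewrite sqrtr_gt0 lt_neqAle addr_ge0 ?sqr_ge0 // andbT eq_sym.
apply/negP => /eqP; move/eqP; rewrite paddr_eq0 ?sqr_ge0 // !sqrf_eq0.
by move=> /andP[/eqP ? /eqP ?]; apply: x0.
Qed.

Lemma rad_le (x : E3) : rad x <= `|x 0 0| + `|x 0 1|.
Proof.
rewrite -[leRHS]ger0_norm ?addr_ge0 // -sqrtr_sqr ler_wsqrtr // sqrrD.
by rewrite !real_normK ?num_real // -addrA lerD2l lerDr mulrn_wge0 // mulr_ge0.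
Qed.



Lemma rad_continuous_within (K : set E3) : {within K, continuous rad}.
Proof. by apply: continuous_subspaceT; exact: rad_continuous. Qed.

(* The radial isotopy pushes [K] along half-planes bounded by the axis. *)
Lemma encircles_axis_trivial (K : set E3) : compact K ->
  encircles (fun x => x 0 0) (fun x => x 0 1) K ->
  trivial_knot [set of_R3 x | x in K].
Proof.
move=> cK [offK meet uniqK].
have [q Kq _] : exists2 x, K x & True.
  by have [|x Kx _] := meet 1 0; [move=> [/eqP]; rewrite oner_eq0 | exists x].
pose toward (x y : E3) :=
  exists2 l, 0 < l & y 0 0 = l * x 0 0 /\ y 0 1 = l * x 0 1.
pose onaxis (x : E3) := x 0 0 = 0 /\ x 0 1 = 0.
(* [k x] is the point of [K] on the half-plane through [x]. On the axis no half-plane is singled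
   out, and [q] is an arbitrary value. *)
have [k kP] : exists k : E3 -> E3, forall x, K (k x) /\
    ((onaxis x -> k x = q) /\ (~ onaxis x -> toward x (k x))).
  suff /choice[k kP] : forall x, exists y, K y /\
      ((onaxis x -> y = q) /\ (~ onaxis x -> toward x y)) by exists k.
  move=> x; have [ax|nax] := pselect (onaxis x); first by exists q.
  have [y Ky [l l0 yl]] := meet _ _ nax.
  by exists y; split=> //; split=> // _; exists l.
have Kk x : K (k x) by case: (kP x).
have k_axis x : onaxis x -> k x = q by case: (kP x) => _ [].
have k_toward x : ~ onaxis x -> toward x (k x) by case: (kP x) => _ [].
have kS (x y : E3) (l : R) : 0 < l ->
    y 0 0 = l * x 0 0 -> y 0 1 = l * x 0 1 -> k y = k x.
  move=> l0 yx0 yx1; have [ax|nax] := pselect (onaxis x).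
    rewrite !k_axis //; case: ax => x0 x1.
    by rewrite /onaxis yx0 yx1 x0 x1 !mulr0.
  have nay : ~ onaxis y.
    move=> [y0 y1]; apply: nax; move: yx0 yx1.
    rewrite y0 y1 => /esym/eqP + /esym/eqP.
    by rewrite !mulf_eq0 (gt_eqF l0) => /eqP x0 /eqP x1; split.
  have [a a0 [xa0 xa1]] := k_toward x nax.
  have [b b0 [yb0 yb1]] := k_toward y nay.
  apply: (uniqK _ _ (b * l / a)) => //; first by rewrite !mulr_gt0 // invr_gt0.
    by rewrite yb0 yx0 xa0; field; rewrite gt_eqF.
  by rewrite yb1 yx1 xa1; field; rewrite gt_eqF.
have k_id x : K x -> k x = x.
  move=> Kx; have [l l0 [xl0 xl1]] := k_toward x (offK x Kx).
  exact: (uniqK _ _ l).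
have ck x : ~ onaxis x -> {for x, continuous k}.
  move=> nax.
  (* Zero cross product and nonnegative inner product are the closed form of lying on the same
     half-plane. The closure adds only points of the axis, which [K] avoids. *)
  apply: (@closed_graph_continuous _ _ K (fun x y : E3 =>
    x 0 0 * y 0 1 - x 0 1 * y 0 0 = 0 /\ 0 <= x 0 0 * y 0 0 + x 0 1 * y 0 1)) => //.
    have : \forall y \near x, ~ onaxis y.
      have /(cvgr_gt _ (@rad_continuous x)) : 0 < rad x by exact: rad_gt0.
      apply: filterS => y /[swap] -[y0 y1].
      by rewrite /rad y0 y1 expr0n addr0 sqrtr0 ltxx.
    apply: filterS => y nay; have [l l0 [-> ->]] := k_toward y nay.
    split; first by ring.
    rewrite [leRHS](_ : _ = l * (y 0 0 ^+ 2 + y 0 1 ^+ 2)); last by ring.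
    by rewrite mulr_ge0 ?addr_ge0 ?sqr_ge0 // ltW.
  move=> y Ky ny.
  have nP : ~ (x 0 0 * y 0 1 - x 0 1 * y 0 0 = 0 /\
      0 <= x 0 0 * y 0 0 + x 0 1 * y 0 1).
    move=> [cr dt]; apply: ny.
    have [l l0 [kl0 kl1]] := k_toward x nax.
    have r0 : 0 < x 0 0 ^+ 2 + x 0 1 ^+ 2.
      by rewrite -sqrtr_gt0; exact: rad_gt0 nax.
    set m := (x 0 0 * y 0 0 + x 0 1 * y 0 1) / (x 0 0 ^+ 2 + x 0 1 ^+ 2).
    have y0E : y 0 0 = m * x 0 0.
      rewrite /m mulrAC; apply: (canRL (mulfK (lt0r_neq0 r0))).
      by apply/eqP; rewrite -subr_eq0 -(mulr0 (- x 0 1)) -cr; apply/eqP; ring.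
    have y1E : y 0 1 = m * x 0 1.
      rewrite /m mulrAC; apply: (canRL (mulfK (lt0r_neq0 r0))).
      by apply/eqP; rewrite -subr_eq0 -(mulr0 (x 0 0)) -cr; apply/eqP; ring.
    have m0 : 0 < m.
      rewrite lt_neqAle divr_ge0 ?(ltW r0) // andbT eq_sym.
      apply/eqP => m0; apply: (offK y Ky).
      by rewrite y0E y1E m0 !mul0r.
    apply: (uniqK _ _ (m / l)) => //; first by rewrite divr_gt0.
      by rewrite kl0 y0E; field; rewrite gt_eqF.
    by rewrite kl1 y1E; field; rewrite gt_eqF.
  pose f (p : E3 * E3) : R := p.2 0 0 * p.1 0 1 - p.2 0 1 * p.1 0 0.
  pose g (p : E3 * E3) : R := p.2 0 0 * p.1 0 0 + p.2 0 1 * p.1 0 1.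
  have c1 j : continuous (fun p : E3 * E3 => p.1 0 j).
    move=> p; apply: (@continuous_comp _ _ _ fst (fun x : E3 => x 0 j)).
      exact: cvg_fst.
    exact: coord_continuous.
  have c2 j : continuous (fun p : E3 * E3 => p.2 0 j).
    move=> p; apply: (@continuous_comp _ _ _ snd (fun x : E3 => x 0 j)).
      exact: cvg_snd.
    exact: coord_continuous.
  have cf : {for (y, x), continuous f}.
    apply: continuousB; apply: continuousM; by [exact: c1 | exact: c2].
  have cg : {for (y, x), continuous g}.
    apply: continuousD; apply: continuousM; by [exact: c1 | exact: c2].
  have [f0|fn0] := eqVneq (f (y, x)) 0.
    have g0 : g (y, x) < 0 by rewrite ltNge; apply/negP => g0; apply: nP.
    have [A nA Ag] := cvgr_lt (g (y, x)) cg _ g0.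
    by exists A => // p /Ag gp [_]; rewrite leNgt => /negP; apply.
  have [A nA Af] := cvgr_neq0 (f (y, x)) cf fn0.
  by exists A => // p /Af fp [f0 _]; move/eqP: fp; apply.
have rK x : K x -> 0 < rad x by move=> /offK /rad_gt0.
have [a /set_mem Ka rad_a] := compact_EVT_min (ex_intro K q Kq) cK
  (@rad_continuous_within K).
have [b /set_mem Kb rad_b] := compact_EVT_max (ex_intro K q Kq) cK
  (@rad_continuous_within K).
have [Z Z0 KZ] : exists2 Z : R, 0 <= Z & forall x, K x -> `|x| <= Z.
  have [M [_ /(_ (`|M| + 1)) MK]] := compact_bounded cK.
  exists (`|M| + 1); first by rewrite addr_ge0.
  by apply: MK; rewrite ltr_pwDr // ler_norm.
pose s x := (rad (k x))^-1.
pose z x := k x 0 2%:R.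
have s_gt0 x : 0 < s x by rewrite invr_gt0 rK.
have s_le x : s x <= (rad a)^-1.
  by rewrite lef_pV2 ?posrE ?rK // rad_a // inE.
have s_ge x : (rad b)^-1 <= s x.
  by rewrite lef_pV2 ?posrE ?rK // rad_b // inE.
have zZ x : `|z x| <= Z by rewrite (le_trans (coord_le_norm _ _)) ?KZ.
(* At time 1 the horizontal coordinates are divided by [rad (k x)] and the height drops by
   [z x * rad x / rad (k x)]; on [K], where [k x = x], this gives radius 1 and height 0. The factor
   [rad x] makes the last entry vanish on the axis, as the other two do, so that the jumps of [k]
   there do no harm. *)
pose D (x : E3) := vec3 ((s x - 1) * x 0 0) ((s x - 1) * x 0 1)
  (- (s x * z x) * rad x).
pose F t (x : E3) := x + t *: D x.
pose c t (x : E3) := 1 - t + t * s x.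
have F0 t x : F t x 0 0 = c t x * x 0 0.
  by rewrite !mxE [in LHS]/= /c; ring.
have F1 t x : F t x 0 1 = c t x * x 0 1.
  by rewrite !mxE [in LHS]/= /c; ring.
have F2 t x : F t x 0 2%:R = x 0 2%:R - t * (s x * z x) * rad x.
  by rewrite !mxE [in LHS]/=; ring.
(* The scaling factor [c t x] is an average of 1 and [s x], so [e] bounds it below uniformly;
   properness rests on this bound. *)
have [e e0 [e1 eb]] : exists2 e : R, 0 < e & e <= 1 /\ e <= (rad b)^-1.
  exists (Num.min 1 (rad b)^-1); last by rewrite !ge_min !lexx orbT.
  by rewrite lt_min ltr01 invr_gt0 rK.
have c_ge t x : 0 <= t <= 1 -> e <= c t x.
  move=> /andP[t0 t1]; have es : e <= s x by exact: le_trans (s_ge x).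
  rewrite /c; nra.
have c_gt0 t x : 0 <= t <= 1 -> 0 < c t x.
  by move=> /(c_ge _ x); exact: lt_le_trans.
have kF t x : 0 <= t <= 1 -> k (F t x) = k x.
  by move=> t01; apply: (kS _ _ (c t x)); [exact: c_gt0 | exact: F0 | exact: F1].
have radF t x : 0 <= t <= 1 -> rad (F t x) = c t x * rad x.
  by move=> t01; apply: rad_scale; [exact/ltW/c_gt0 | exact: F0 | exact: F1].
have isoF : ambient_isotopy
    (fun t => omap (fun x : E3 => x + t *: D x) : S3 R -> S3 R).
  apply: straight_line_isotopy.
  - move=> x; change {for x, continuous (fun y : E3 => vec3
      ((s y - 1) * y 0 0) ((s y - 1) * y 0 1) (- (s y * z y) * rad y))}.
    have [[x0 x1]|nax] := pselect (onaxis x).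
      have sB y : `|s y - 1| <= (rad a)^-1 + 1.
        by rewrite (le_trans (ler_normB _ _)) // normr1 lerD2r gtr0_norm.
      have szB y : `|- (s y * z y)| <= (rad a)^-1 * Z.
        by rewrite normrN normrM ler_pM // gtr0_norm.
      apply: vec3_continuous.
      + exact: (bounded_mul_continuous sB (@coord_continuous _ _ _ 0 0 x)).
      + exact: (bounded_mul_continuous sB (@coord_continuous _ _ _ 0 1 x)).
      + apply: (bounded_mul_continuous szB (@rad_continuous x)).
        by rewrite /rad x0 x1 expr0n addr0 sqrtr0.
    have cs : {for x, continuous s}.
      apply: continuousV; first by rewrite gt_eqF // rK.
      by apply: continuous_comp; [exact: ck | exact: rad_continuous].
    have cz : {for x, continuous z}.
      apply: (@continuous_comp _ _ _ k (fun y : E3 => y 0 2%:R)).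
        exact: ck.
      exact: coord_continuous.
    have cs1 : {for x, continuous (fun y => s y - 1)}.
      by apply: continuousB => //; exact: cst_continuous.
    apply: vec3_continuous.
    + by apply: continuousM => //; exact: coord_continuous.
    + by apply: continuousM => //; exact: coord_continuous.
    + apply: continuousM; last exact: rad_continuous.
      by apply: continuousN; exact: continuousM.
  - move=> t t01.
    (* The motion preserves each half-plane, so [s], [z] and [c t] agree at a point and at its
       image, and the formula for the image can be solved for the point. *)
    exists (fun y : E3 => vec3 (y 0 0 / c t y) (y 0 1 / c t y)
      (y 0 2%:R + t * (s y * z y) * rad y / c t y)) => x; rewrite -/(F t _).
    + have cF : c t (F t x) = c t x by rewrite /c /s kF.
      apply: row3P; rewrite !vec3E cF ?F0 ?F1 ?F2 ?radF //.
      * by rewrite mulrC mulKf // gt_eqF // c_gt0.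
      * by rewrite mulrC mulKf // gt_eqF // c_gt0.
      * rewrite /s /z kF //; field; rewrite !gt_eqF ?c_gt0 ?rK //.
    + set y := vec3 _ _ _.
      have kx : k y = k x.
        apply: (kS _ _ (c t x)^-1); first by rewrite invr_gt0 c_gt0.
          by rewrite vec3E mulrC.
        by rewrite vec3E mulrC.
      have ry : rad y = (c t x)^-1 * rad x.
        apply: rad_scale; first by rewrite invr_ge0 ltW ?c_gt0.
          by rewrite vec3E mulrC.
        by rewrite vec3E mulrC.
      have cy : c t y = c t x by rewrite /c /s kx.
      apply: row3P; rewrite ?F0 ?F1 ?F2 ?cy ?vec3E.
      * by rewrite mulrC divfK // gt_eqF // c_gt0.
      * by rewrite mulrC divfK // gt_eqF // c_gt0.
      * rewrite /s /z kx ry; field; rewrite !gt_eqF ?c_gt0 ?rK //.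
  - move=> M.
    exists (`|M| / e + (`|M| + (rad a)^-1 * Z * (`|M| / e + `|M| / e))).
    move=> t x t01 FM.
    have t1 : `|t| <= 1 by case/andP: t01 => t0 t1; rewrite ger0_norm.
    have FM' j : `|F t x 0 j| <= `|M|.
      by rewrite (le_trans (coord_le_norm _ _)) // (le_trans FM) // ler_norm.
    have Me : 0 <= `|M| / e by rewrite divr_ge0 // ltW.
    have xj j : F t x 0 j = c t x * x 0 j -> `|x 0 j| <= `|M| / e.
      move=> Fj; rewrite ler_pdivlMr // (le_trans _ (FM' j)) // Fj normrM mulrC.
      by rewrite ler_wpM2r // (le_trans (c_ge t x t01)) // ler_norm.
    have x0 := xj 0 (F0 t x); have x1 := xj 1 (F1 t x).
    have a0 : 0 < (rad a)^-1 by rewrite invr_gt0 rK.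
    have rest : 0 <= (rad a)^-1 * Z * (`|M| / e + `|M| / e).
      by rewrite mulr_ge0 ?addr_ge0 // mulr_ge0 // ltW.
    apply: norm_le_coord.
    + by rewrite (le_trans x0) // lerDl addr_ge0.
    + by rewrite (le_trans x1) // lerDl addr_ge0.
    + rewrite -[leLHS]add0r lerD //.
      have -> : x 0 2%:R = F t x 0 2%:R + t * (s x * z x) * rad x.
        by rewrite F2 subrK.
      rewrite (le_trans (ler_normD _ _)) // lerD // !normrM.
      rewrite (gtr0_norm (s_gt0 x)) (ger0_norm (sqrtr_ge0 _)).
      apply: ler_pM; rewrite ?sqrtr_ge0 ?mulr_ge0 ?(ltW (s_gt0 x)) //.
        rewrite -[leRHS]mul1r ler_pM ?mulr_ge0 ?(ltW (s_gt0 x)) //.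
        by rewrite ler_pM // ltW.
      by rewrite (le_trans (rad_le x)) // lerD.
apply: (trivial_knot_isotopy isoF).
have -> : omap (fun x : E3 => x + 1 *: D x) @` (of_R3 @` K) = @standard_circle R.
  have t1 : 0 <= (1 : R) <= 1 by rewrite ler01 lexx.
  have c1 x : c 1 x = s x by rewrite /c subrr add0r mul1r.
  rewrite image_comp /standard_circle.
  apply/seteqP; split=> [_ [x Kx <-]|_ [u [u1 u2] <-]].
    exists (F 1 x) => //=; rewrite F0 F1 F2 c1 /z /s k_id //.
    rewrite !exprMn -mulrDr -[X in _ * X]sqr_sqrtr ?addr_ge0 ?sqr_ge0 //.
    rewrite -/(rad x) -exprMn mulVf ?gt_eqF ?rK // expr1n; split=> //.
    by field; rewrite gt_eqF ?rK.
  have nau : ~ onaxis u.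
    by move=> [u0 u10]; move/eqP: u1; rewrite u0 u10 expr0n addr0 eq_sym oner_eq0.
  have [l l0 [kl0 kl1]] := k_toward u nau.
  have rl : rad (k u) = l.
    by rewrite (@rad_scale u _ l (ltW l0) kl0 kl1) /rad u1 sqrtr1 mulr1.
  exists (k u) => //=; congr Some.
  rewrite -/(F 1 (k u)); apply: row3P;
    rewrite ?F0 ?F1 ?F2 ?c1 /s /z (k_id _ (Kk u)) rl.
  - by rewrite kl0 mulKf // gt_eqF.
  - by rewrite kl1 mulKf // gt_eqF.
  - by rewrite u2; field; rewrite gt_eqF.
exact: ambient_isotopic_refl.
Qed.

(** * Reduction of an arbitrary non-horizontal axis to the vertical one *)

Implicit Types (X Y : E3 -> R) (K : set E3).

Lemma addZE (x y : E3) (t : R) j : (x + t *: y) 0 j = x 0 j + t * y 0 j.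
Proof. by rewrite !mxE. Qed.

Lemma encircles_swap X Y K : encircles X Y K -> encircles Y X K.
Proof.
move=> [off meet uniqK]; split=> [x Kx [Y0 X0]|a b ab0|x y l Kx Ky l0 *].
- exact: off Kx (conj X0 Y0).
- have [|x Kx [l l0 [Xx Yx]]] := meet b a; first by move=> [? ?]; apply: ab0.
  by exists x => //; exists l.
- exact: (uniqK _ _ l).
Qed.

(** Lets [axis_coord] stay free of division, hence integral on integer data. A negative factor
    merely exchanges opposite half-planes. *)
Lemma encircles_scale X Y K (d : R) : d != 0 ->
  encircles (fun x => d * X x) (fun x => d * Y x) K -> encircles X Y K.
Proof.
move=> d0 [off meet uniqK]; split=> [x Kx [X0 Y0]|a b ab0|x y l Kx Ky l0 XE YE].
- by apply: (off x Kx); rewrite X0 Y0 mulr0.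
- have [|x Kx [l l0 [Xx Yx]]] := meet (d * a) (d * b).
    move=> [/eqP + /eqP]; rewrite !mulf_eq0 (negPf d0) => /eqP ? /eqP ?.
    exact: ab0.
  exists x => //; exists l => //.
  by split; apply: (mulfI d0); rewrite mulrCA.
- by apply: (uniqK _ _ l) => //; rewrite ?XE ?YE mulrCA.
Qed.

Lemma encircles_image X Y (S : E3 -> E3) K :
  encircles (X \o S) (Y \o S) K -> encircles X Y (S @` K).
Proof.
move=> [off meet uniqK].
split=> [_ [x Kx <-]|a b ab0|_ _ l [x Kx <-] [y Ky <-] l0 XE YE].
- exact: off.
- have [x Kx xl] := meet a b ab0.
  by exists (S x) => //; exists x.
- by congr S; exact: (uniqK _ _ l).
Qed.

(* [axis_coord p d 0] and [axis_coord p d 1] vanish exactly on the line through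
   [p] in the direction [d], provided [d 0 2 != 0]. *)
Definition axis_coord (p d : E3) (j : 'I_3) (x : E3) : R :=
  d 0 2%:R * (x 0 j - p 0 j) - (x 0 2%:R - p 0 2%:R) * d 0 j.

(** The displacement is horizontal and depends on the height alone, so subtracting it inverts the
    motion. At time 1 the horizontal coordinates are [axis_coord p d] divided by [d 0 2%:R], and the
    given line has become vertical. *)
Lemma encircles_trivial (p d : E3) K : compact K -> d 0 2%:R != 0 ->
  encircles (axis_coord p d 0) (axis_coord p d 1) K ->
  trivial_knot [set of_R3 x | x in K].
Proof.
move=> cK d0 encK.
pose u j := d 0 j / d 0 2%:R.
pose h j (x : E3) := - (p 0 j + (x 0 2%:R - p 0 2%:R) * u j).
pose D (x : E3) := vec3 (h 0 x) (h 1 x) 0.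
have D2 (x y : E3) : x 0 2%:R = y 0 2%:R -> D x = D y by rewrite /D /h => ->.
have ch j : continuous (h j).
  move=> x; change {for x, continuous (fun y : E3 =>
    - (p 0 j + (y 0 2%:R - p 0 2%:R) * u j))}.
  apply: continuousN; apply: continuousD; first exact: cst_continuous.
  apply: continuousM; last exact: cst_continuous.
  by apply: continuousB; [exact: coord_continuous | exact: cst_continuous].
have cD : continuous D.
  move=> x; apply: vec3_continuous; [exact: ch | exact: ch |].
  exact: cst_continuous.
have D02 x : D x 0 2%:R = 0 by rewrite vec3E.
have isoD : ambient_isotopy
    (fun t => omap (fun x : E3 => x + t *: D x) : S3 R -> S3 R).
  apply: straight_line_isotopy => //.
  - move=> t _; exists (fun x => x - t *: D x) => x.
      by rewrite (D2 _ x) ?addrK // addZE D02 mulr0 addr0.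
    by rewrite (D2 _ x) ?subrK // -scaleNr addZE D02 mulr0 addr0.
  - move=> M; pose C j := `|p 0 j| + (`|M| + `|p 0 2%:R|) * `|u j|.
    have C0 j : 0 <= C j by rewrite addr_ge0 ?mulr_ge0 ?addr_ge0.
    exists (`|M| + (C 0 + C 1)) => t x t01 FM.
    have t1 : `|t| <= 1 by case/andP: t01 => t0 t1; rewrite ger0_norm.
    have FM' j : `|(x + t *: D x) 0 j| <= `|M|.
      by rewrite (le_trans (coord_le_norm _ _)) // (le_trans FM) // ler_norm.
    have x2 : `|x 0 2%:R| <= `|M|.
      by have := FM' 2%:R; rewrite addZE D02 mulr0 addr0.
    have hC j : `|t * h j x| <= C j.
      rewrite normrM -[leRHS]mul1r ler_pM // normrN (le_trans (ler_normD _ _)) //.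
      rewrite lerD2l normrM ler_wpM2r // (le_trans (ler_normB _ _)) // lerD2r //.
    have xj j : (x + t *: D x) 0 j = x 0 j + t * h j x -> `|x 0 j| <= `|M| + C j.
      move=> Fj; rewrite (_ : x 0 j = (x + t *: D x) 0 j - t * h j x).
        by rewrite (le_trans (ler_normB _ _)) // lerD.
      by rewrite Fj addrK.
    apply: norm_le_coord.
    + rewrite (le_trans (xj 0 _)) ?lerD2l ?lerDl //.
      by rewrite addZE vec3E.
    + rewrite (le_trans (xj 1 _)) ?lerD2l ?lerDr //.
      by rewrite addZE vec3E.
    + by rewrite (le_trans x2) // lerDl addr_ge0.
apply: (trivial_knot_isotopy isoD).
pose S (x : E3) := x + 1 *: D x.
have -> : omap (fun x : E3 => x + 1 *: D x) @` (of_R3 @` K) = of_R3 @` (S @` K).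
  by rewrite !image_comp.
apply: encircles_axis_trivial.
  apply: continuous_compact cK; apply: continuous_subspaceT => x.
  change {for x, continuous (fun y : E3 => y + 1 *: D y)}.
  by apply: continuousD; [exact: cvg_id | apply: continuousZl_tmp; exact: cD].
apply: encircles_image; apply: (encircles_scale d0).
have SE j x : D x 0 j = h j x -> d 0 2%:R * S x 0 j = axis_coord p d j x.
  move=> DE; rewrite /S addZE DE /h /u /axis_coord; field; exact: d0.
rewrite (_ : (fun x => _) = axis_coord p d 0); last first.
  by apply/funext => x /=; apply: SE; rewrite vec3E.
rewrite (_ : (fun x => _ * _) = axis_coord p d 1) //.
by apply/funext => x /=; apply: SE; rewrite vec3E.
Qed.

End encircling.

(** * Star-shaped polygons in the plane *)

(* If [r x y] says that the plane vector [y] is less than a half-turn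
   counterclockwise from [x], then [star r c] says that [c] winds exactly once:
   from its head [a], a block to the left of [a] is followed by a block to the
   right of it. *)
Definition star (T : Type) (r : rel T) (c : seq T) : bool :=
  if c is a :: s then
    path r a (rcons s a) && all (r^~ a) (drop (find (fun x => ~~ r a x) s) s)
  else false.

Lemma star_map (T U : Type) (g : T -> U) (r : rel U) (c : seq T) :
  star r (map g c) = star (fun x y => r (g x) (g y)) c.
Proof.
case: c => //= a s; rewrite -map_rcons path_map find_map -map_drop all_map.
by [].
Qed.

Lemma eq_star (T : Type) (r r' : rel T) (c : seq T) :
  r =2 r' -> star r c = star r' c.
Proof.
by move=> rr'; congr star; apply/funext => x; apply/funext => y.
Qed.

Fixpoint count_steps (T : Type) (r : rel T) (x : T) (s : seq T) : nat :=
  if s is y :: s' then r x y + count_steps r y s' else 0.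

Lemma count_steps_cat (T : Type) (r : rel T) x s1 s2 :
  count_steps r x (s1 ++ s2) =
  (count_steps r x s1 + count_steps r (last x s1) s2)%N.
Proof. by elim: s1 x => //= y s1 IH x; rewrite IH addnA. Qed.

Lemma count_next (T : eqType) (r : rel T) x s : uniq (x :: s) ->
  count (fun y => r y (next (x :: s) y)) (x :: s) =
  count_steps r x (rcons s x).
Proof.
(* The closing vertex [z] is separated from the head, which changes during the induction. *)
suff gen z : uniq (x :: s) ->
    count (fun y => r y (next_at y z x s)) (x :: s) =
    count_steps r x (rcons s z) by exact: gen.
elim: s x => [|y s IH] x; first by rewrite /= eqxx.
rewrite [uniq _]/= => /andP[xs /IH {}IH].
rewrite [RHS]/= -IH [LHS]/= eqxx; congr (_ + _)%N.
apply: (@eq_in_count _ _ _ (y :: s)) => v vs /=.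
by case: eqP => // vx; move: xs; rewrite -vx vs.
Qed.

Section planar.
Variables (R : realFieldType) (T : eqType) (W : T -> R * R).

Definition cross (u v : R * R) : R := u.1 * v.2 - u.2 * v.1.

Let ccw : rel T := fun x y => 0 < cross (W x) (W y).

(** When [ccw x y] holds, this places [u] in the sector from [W x] (included) to [W y] (excluded).
    Half-open sectors count a ray through a vertex only once. *)
Definition in_cone (u : R * R) : rel T :=
  fun x y => (0 <= cross (W x) u) && (cross (W y) u < 0).

(** Cross products with [u] inherit the linear relation between three plane vectors, and its
    coefficients are positive here; the rest is a discussion of signs. *)
Lemma in_cone_split u x y z : ccw x y -> ccw y z -> ccw x z ->
  (in_cone u x y + in_cone u y z)%N = in_cone u x z.
Proof.
rewrite /ccw /in_cone => xy yz xz.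
have : cross (W y) (W z) * cross (W x) u + cross (W x) (W y) * cross (W z) u =
  cross (W x) (W z) * cross (W y) u by rewrite /cross; ring.
move: xy yz xz; move: (cross (W x) (W y)) (cross (W y) (W z)) (cross (W x) (W z)).
move: (cross (W x) u) (cross (W y) u) (cross (W z) u) => A B C p q r p0 q0 r0 E.
case: (leP 0 A) => A0; case: (leP 0 B) => B0; case: (leP 0 C) => C0 //=;
  exfalso; nra.
Qed.

(** The origin lies inside the triangle, so the three half-open sectors tile the punctured plane. *)
Lemma in_cone_triangle u x y z : u <> (0, 0) ->
  ccw x y -> ccw y z -> ccw z x ->
  (in_cone u x y + in_cone u y z + in_cone u z x)%N = 1%N.
Proof.
rewrite /ccw /in_cone => u0 xy yz zx.
have E : cross (W y) (W z) * cross (W x) u + cross (W x) (W y) * cross (W z) u +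
  cross (W z) (W x) * cross (W y) u = 0 by rewrite /cross; ring.
(* [u] is recovered from its cross products with two independent vectors, so these cannot both
   vanish. *)
have E1 : cross (W x) (W y) * u.1 =
    (W y).1 * cross (W x) u - (W x).1 * cross (W y) u by rewrite /cross; ring.
have E2 : cross (W x) (W y) * u.2 =
    (W y).2 * cross (W x) u - (W x).2 * cross (W y) u by rewrite /cross; ring.
have nz : ~ (cross (W x) u = 0 /\ cross (W y) u = 0).
  move=> [Cx Cy]; apply: u0; move: E1 E2; rewrite Cx Cy !mulr0 subrr.
  move=> /eqP + /eqP; rewrite !mulf_eq0 gt_eqF //= => /eqP + /eqP.
  by case: u {E Cx Cy} => u1 u2 /= -> ->.
move: {E1 E2 u0} nz E xy yz zx.
move: (cross (W x) (W y)) (cross (W y) (W z)) (cross (W z) (W x)).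
move: (cross (W x) u) (cross (W y) u) (cross (W z) u) => A B C p q r nz E p0 q0 r0.
case: (leP 0 A) => A0; case: (leP 0 B) => B0; case: (leP 0 C) => C0 //=; exfalso.
  by apply: nz; split; nra.
nra.
Qed.

Lemma count_cones_left u x (s : seq T) :
  s != [::] -> path ccw x s -> all (ccw x) s ->
  count_steps (in_cone u) x s = in_cone u x (last x s).
Proof.
elim/last_ind: s => // s z IH _; rewrite rcons_path all_rcons last_rcons.
move=> /andP[xs sz] /andP[xz axs].
rewrite -cats1 count_steps_cat /= addn0.
have [->|s0] := eqVneq s [::]; first by [].
rewrite IH //; apply: in_cone_split => //.
move: s0 axs; case/lastP: s {IH xs sz} => // s y _.
by rewrite all_rcons last_rcons => /andP[].
Qed.

Lemma count_cones_right u x y s : path ccw y (rcons s x) ->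
  all (ccw^~ x) (y :: s) ->
  count_steps (in_cone u) y (rcons s x) = in_cone u y x.
Proof.
elim: s y => [|z s IH] y /=; first by rewrite addn0.
move=> /andP[yz zs] /and3P[yx zx sx]; rewrite IH //=; last by rewrite zx.
exact: in_cone_split.
Qed.

(** The sectors of the left block merge into one, and so do those of the right block. With the step
    between the blocks, three sectors remain, those of a triangle around the origin. *)
Lemma star_count_cones u x s : u <> (0, 0) -> star ccw (x :: s) ->
  count_steps (in_cone u) x (rcons s x) = 1%N.
Proof.
have irr y : ccw y y = false by rewrite /ccw /cross mulrC subrr ltxx.
have anti y z : ccw y z -> ccw z y -> False by rewrite /ccw /cross; nra.
move=> u0; rewrite /star => /andP[].
set k := find _ s.
have : all (ccw x) (take k s).
  rewrite -[all _ _]negbK -has_predC has_take_leq ?find_size //.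
  by rewrite ltnn.
have := cat_take_drop k s; move: (take k s) (drop k s) => s1 s2 <- {k s}.
rewrite rcons_cat cat_path => left1 /andP[p1 p2] right2.
rewrite count_steps_cat.
(* An empty block would put a vertex to the left of itself, or two vertices each to the left of the
   other. *)
case: s2 p2 right2 => [|y s2].
  rewrite /= andbT => lx _; exfalso.
  case/lastP: s1 left1 {p1} lx => [|s1 z]; first by rewrite irr.
  by rewrite all_rcons last_rcons => /andP[/anti].
rewrite [path _ _ _]/= => /andP[ly p2] right2 /=.
have s10 : s1 != [::].
  case: s1 left1 p1 ly => //= _ _ xy.
  by case/andP: right2 => /anti.
rewrite count_cones_left // count_cones_right // addnA.
apply: in_cone_triangle => //; last by case/andP: right2.
case/lastP: s1 s10 left1 {p1 ly} => // s1 z _.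
by rewrite all_rcons last_rcons => /andP[].
Qed.

End planar.

(** * From planar winding numbers to polygons in space *)

Section polygon.
Variables (R : realType) (V : finType) (pos : V -> 'rV[R]_3).
Local Notation E3 := 'rV[R]_3.

Definition polygon (c : seq V) : set E3 :=
  [set (1 - t) *: pos x + t *: pos (next c x) | x in [set` c] & t in `[0, 1]].

Lemma segment_continuous (a b : E3) :
  continuous (fun t : R => (1 - t) *: a + t *: b).
Proof.
move=> t; apply: cvgD; apply: cvgZr_tmp; last exact: cvg_id.
by apply: cvgB; [exact: cvg_cst | exact: cvg_id].
Qed.

Lemma polygon_compact (c : seq V) : compact (polygon c).
Proof.
have -> : polygon c = \bigcup_(x in [set` c])
    [set (1 - t) *: pos x + t *: pos (next c x) | t in `[0, 1]].
  apply/seteqP; split=> [_ [x xc [t t01 <-]]|_ [x xc [t t01 <-]]].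
    by exists x => //; exists t.
  by exists x => //; exists t.
rewrite bigcup_seq; elim/big_ind: _ => [|A B|x _].
- exact: compact0.
- exact: compactU.
- apply: continuous_compact; last exact: segment_compact.
  by apply: continuous_subspaceT; exact: segment_continuous.
Qed.

Lemma polygon_rot (c : seq V) n : uniq c -> polygon (rot n c) = polygon c.
Proof.
move=> uc; have E x : next (rot n c) x = next c x by exact: next_rot.
apply/seteqP; split=> _ [x + [t t01 <-]].
  by rewrite /= mem_rot => xc; exists x => //; exists t; rewrite ?E.
by move=> xc; exists x; rewrite /= ?mem_rot //; exists t; rewrite ?E.
Qed.

Variables (X Y : E3 -> R).
Hypothesis affX : forall t a b, X ((1 - t) *: a + t *: b) = (1 - t) * X a + t * X b.
Hypothesis affY : forall t a b, Y ((1 - t) *: a + t *: b) = (1 - t) * Y a + t * Y b.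

(** Each nonzero direction lies in the sector of exactly one edge: at least one gives existence of
    the meeting point, at most one reduces uniqueness to a single edge. *)
Lemma star_encircles (c : seq V) : uniq c ->
  star (fun x y => 0 < cross (X (pos x), Y (pos x)) (X (pos y), Y (pos y))) c ->
  encircles X Y (polygon c).
Proof.
pose W x : R * R := (X (pos x), Y (pos x)).
case: c => // o s; set c := o :: s => uc sc.
have ccw x : x \in c -> 0 < cross (W x) (W (next c x)).
  move: sc; rewrite /star => /andP[+ _].
  by rewrite -[path _ _ _]/(path.cycle _ c) => /next_cycle; apply.
have one u : u <> (0, 0) -> count (fun x => in_cone W u x (next c x)) c = 1%N.
  by move=> u0; rewrite count_next //; exact: star_count_cones.
(* A vertex is assigned to the edge leaving it, in accordance with the half-open sectors. *)
have normal p : polygon c p -> exists x t, [/\ x \in c, 0 <= t < 1 &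
    p = (1 - t) *: pos x + t *: pos (next c x)].
  move=> [x xc [t]]; rewrite /= in_itv /= => /andP[t0 t1] <-.
  have [t1E|tn1] := eqVneq t 1.
    exists (next c x), 0; rewrite mem_next lexx ltr01; split=> //.
    by rewrite t1E subrr !scale0r subr0 scale1r addr0 add0r.
  by exists x, t; split=> //; rewrite t0 lt_neqAle tn1.
have cone x t u l : x \in c -> 0 <= t < 1 -> 0 < l ->
    X ((1 - t) *: pos x + t *: pos (next c x)) = l * u.1 ->
    Y ((1 - t) *: pos x + t *: pos (next c x)) = l * u.2 ->
    in_cone W u x (next c x).
  move=> xc /andP[t0 t1] l0; rewrite affX affY => Xu Yu.
  have := ccw x xc; rewrite /in_cone -(pmulr_rge0 _ l0) -(pmulr_rlt0 _ l0).
  have -> : l * cross (W x) u = t * cross (W x) (W (next c x)).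
    by rewrite /cross mulrBr !(mulrCA l) -Xu -Yu /=; ring.
  have -> : l * cross (W (next c x)) u = (t - 1) * cross (W x) (W (next c x)).
    by rewrite /cross mulrBr !(mulrCA l) -Xu -Yu /=; ring.
  move=> w0; rewrite mulr_ge0 ?(ltW w0) //= pmulr_llt0 // subr_lt0 //.
split.
- move=> _ /normal[x [t [xc /andP[t0 t1] ->]]]; rewrite affX affY => -[X0 Y0].
  have {}X0 : (1 - t) * X (pos x) = - (t * X (pos (next c x))).
    by apply/eqP; rewrite -addr_eq0; exact/eqP.
  have {}Y0 : (1 - t) * Y (pos x) = - (t * Y (pos (next c x))).
    by apply/eqP; rewrite -addr_eq0; exact/eqP.
  have /lt0r_neq0/eqP := ccw x xc; apply.
  have : (1 - t) * cross (W x) (W (next c x)) = 0.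
    transitivity ((1 - t) * X (pos x) * Y (pos (next c x)) -
      (1 - t) * Y (pos x) * X (pos (next c x))); first by rewrite /cross /=; ring.
    by rewrite X0 Y0; ring.
  by move/eqP; rewrite mulf_eq0 subr_eq0 gt_eqF //= => /eqP.
- move=> a b ab0; pose u := (a, b).
  have u0 : u <> (0, 0) by move=> [a0 b0]; exact: ab0.
  have : has (fun x => in_cone W u x (next c x)) c by rewrite has_count one.
  move=> /hasP[x xc /andP[]]; have := ccw x xc.
  set y := next c x => w0 A0 B0.
  pose A := cross (W x) u; pose B := cross (W y) u.
  have AB : 0 < A - B by rewrite subr_gt0 (lt_le_trans B0).
  (* Along the edge the cross product with [u] runs affinely from [A] to [B], and vanishes at the
     parameter [A / (A - B)]. *)
  exists ((1 - A / (A - B)) *: pos x + (A / (A - B)) *: pos y).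
    exists x => //; exists (A / (A - B)) => //.
    rewrite /= in_itv /= divr_ge0 ?(ltW AB) //= ler_pdivrMr // mul1r.
    by rewrite lerDl oppr_ge0 ltW.
  exists (cross (W x) (W y) / (A - B)); first by rewrite divr_gt0.
  have := lt0r_neq0 AB; rewrite affX affY /A /B /cross /= => AB0.
  by split; field.
- move=> p q l /normal[x [t [xc t01 pE]]] /normal[y [s' [yc s01 qE]]] l0 XE YE.
  pose u := (X p, Y p).
  have u0 : u <> (0, 0).
    move=> [X0 Y0]; have := cone x t (0, 0) 1 xc t01 ltr01.
    rewrite -pE /= X0 Y0 mulr0 /in_cone /cross /= !mulr0 subrr ltxx andbF.
    by move=> /(_ erefl erefl).
  have xu : in_cone W u x (next c x).
    by apply: (cone x t u 1) => //; rewrite -pE mul1r.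
  have yu : in_cone W u y (next c y) by apply: (cone y s' u l); rewrite -?qE.
  have yx : y = x.
    have := one u u0; rewrite -size_filter.
    set f := [seq z <- c | _] => f1.
    have : x \in f by rewrite mem_filter xu.
    have : y \in f by rewrite mem_filter yu.
    by case: f f1 => [|z []] // _; rewrite !inE => /eqP-> /eqP->.
  move: XE YE; rewrite pE qE yx !affX !affY => XE YE.
  have /lt0r_neq0 w0 := ccw x xc; move: w0; set w := cross _ _ => w0.
  set x' := next c x in XE YE w w0 *.
  (* Crossing with either endpoint isolates one barycentric coordinate. Both are multiplied by [l]
     and both pairs sum to 1, so [l = 1]. *)
  have ts : s' = l * t.
    apply: (mulIf w0).
    transitivity (X (pos x) * ((1 - s') * Y (pos x) + s' * Y (pos x')) -
      Y (pos x) * ((1 - s') * X (pos x) + s' * X (pos x'))).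
      by rewrite /w /cross /=; ring.
    by rewrite XE YE /w /cross /=; ring.
  have ts' : 1 - s' = l * (1 - t).
    apply: (mulIf w0).
    transitivity (Y (pos x') * ((1 - s') * X (pos x) + s' * X (pos x')) -
      X (pos x') * ((1 - s') * Y (pos x) + s' * Y (pos x'))).
      by rewrite /w /cross /=; ring.
    by rewrite XE YE /w /cross /=; ring.
  have l1 : l = 1 by move: ts'; rewrite ts; lra.
  by rewrite ts l1 mul1r.
Qed.
End polygon.

(** * Axes of short cycles on the moment curve *)

Section certificate.
Local Open Scope Z_scope.

Definition zvec : Type := Z * Z * Z.
Implicit Types (a b c p d v : zvec).

Definition zcomb (m n : Z) a b : zvec :=
  (m * a.1.1 + n * b.1.1, m * a.1.2 + n * b.1.2, m * a.2 + n * b.2).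

Definition zmoment (i : nat) : zvec :=
  let t := Z.of_nat i in (t, t * t, t * t * t).

Definition zvertex (i : nat) : zvec := zcomb 120 0 (zmoment i) (0, 0, 0).

Definition zproj p d v : Z * Z :=
  (d.2 * (v.1.1 - p.1.1) - (v.2 - p.2) * d.1.1,
   d.2 * (v.1.2 - p.1.2) - (v.2 - p.2) * d.1.2).

Definition zccw (u v : Z * Z) : bool := 0 <? u.1 * v.2 - u.2 * v.1.

Definition winds_about p d (vs : seq zvec) : bool :=
  let ws := [seq zproj p d v | v <- vs] in
  ~~ (d.2 =? 0) && (star zccw ws || star (fun u w => zccw w u) ws).

Definition shifted (s : Z) a b c : zvec := zcomb (120 - 2 * s) s b (zcomb 1 1 a c).

(* Seen along a line close to the diagonal through [b] and [z], the polygon is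
   governed by its other vertices, while [b] and [z] become short vectors.
   Pushing the line off [b] by a small multiple of [a + c - 2 b], with the right
   sign, makes the short vector at [b] point between its neighbours [a] and [c];
   likewise at [z], with neighbours [y] and [a].  The factor 120 is the inverse
   of a perturbation that is small enough for all short cycles; being divisible
   by 3, it also keeps the centroid of a triangle integral. *)
Definition near_lines a b c y z : seq (zvec * zvec) :=
  [seq (p, zcomb 1 (-1) q p) | p <- [:: shifted 1 a b c; shifted (-1) a b c],
                               q <- [:: shifted 1 y z a; shifted (-1) y z a]].

(** For a triangle, the vertical line through the centroid works: the shadow is a triangle inscribed
    in a parabola. In a quadrilateral [c] is adjacent to both ends of the diagonal and plays the
    parts of [c] and [y]. *)
Definition trial_lines (vs : seq zvec) : seq (zvec * zvec) :=
  match vs with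
  | [:: a; b; c] => [:: (zcomb 40 40 a (zcomb 1 1 b c), (0, 0, 1))]
  | [:: a; b; c; z] => near_lines a b c c z
  | [:: a; b; c; y; z] => near_lines a b c y z
  | _ => [::]
  end.

(** Rotating the cycle varies the diagonal. The lines are built from unscaled points because
    [shifted] and the centroid already carry the factor 120 of [zvertex]. *)
Definition has_axis (c : seq nat) : bool :=
  has (fun n => has (fun l => winds_about l.1 l.2 (map zvertex (rot n c)))
                    (trial_lines (map zmoment (rot n c))))
      (iota 0 (size c)).

End certificate.

(** A depth-first search over sequences of distinct labels whose head is the least, so that each
    directed cycle is visited in one rotation only. *)
Fixpoint all_extensions (P : pred (seq nat)) (k : nat) (c : seq nat) : bool :=
  P c && if k is k'.+1 then
    all (fun i => [|| (i <= head 0 c)%N, i \in c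
                    | all_extensions P k' (rcons c i)]) (iota 0 8)
  else true.

Lemma all_extensionsP P k c s : all_extensions P k c -> c != [::] ->
  (size s <= k)%N -> uniq (c ++ s) ->
  all (fun i => (head 0 c < i)%N && (i < 8)%N) s -> P (c ++ s).
Proof.
elim: k c s => [|k IH] c [|i s].
- by rewrite cats0 => /andP[].
- by [].
- by rewrite cats0 => /andP[].
move=> /andP[_ /allP ext] c0 sk uc /andP[/andP[ci i8] cs].
have := ext i; rewrite mem_iota i8 => /(_ isT) /or3P[|ic|exti].
- by rewrite leqNgt ci.
- by move: uc; rewrite cat_uniq /= ic /= andbF.
- rewrite -cat_rcons; apply: IH => //.
  + by case: c {ext c0 ci cs uc exti}.
  + by rewrite cat_rcons.
  + by case: c c0 cs {ext ci uc exti}.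
Qed.

Lemma short_cycles_have_axis (i : nat) (s : seq nat) : (i < 8)%N ->
  (2 <= size s <= 4)%N -> uniq (i :: s) ->
  all (fun j => (i < j)%N && (j < 8)%N) s -> has_axis (i :: s).
Proof.
move=> i8 /andP[s2 s4] us is_.
(* The search also tests prefixes that are too short to be polygons; these pass by fiat. *)
pose P c := (size c <= 2)%N || has_axis c.
have /allP/(_ i) : all (fun i => all_extensions P 4 [:: i]) (iota 0 8).
  (* Lazy conversion: [vm_compute] would not short-circuit [||] and [has]. *)
  reflexivity.
rewrite mem_iota i8 => /(_ isT) ext.
by have := all_extensionsP ext isT s4 us is_; rewrite /P /= leqNgt ltnS s2.
Qed.

(** * Transfer of the integer certificate to real coordinates *)

Section real_certificate.
Variable R : realType.
Local Notation E3 := 'rV[R]_3.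

Definition zR (z : Z) : R := (int_of_Z z)%:~R.

Lemma zRB x y : zR (Z.sub x y) = zR x - zR y.
Proof. by rewrite /zR -intrB; congr _%:~R; lia. Qed.

Lemma zRM x y : zR (Z.mul x y) = zR x * zR y.
Proof. by rewrite /zR -intrM; congr _%:~R; lia. Qed.

Lemma zR_gt0 z : (0 < zR z) = Z.ltb 0 z.
Proof. by rewrite ltr0z; apply/idP/idP; lia. Qed.

Lemma zR_eq0 z : (zR z == 0) = Z.eqb z 0.
Proof. by rewrite intr_eq0; apply/idP/idP; lia. Qed.

Definition realvec (v : zvec) : E3 := vec3 (zR v.1.1) (zR v.1.2) (zR v.2).

Lemma axis_coord_zproj (p d v : zvec) :
  (axis_coord (realvec p) (realvec d) 0 (realvec v) = zR (zproj p d v).1) *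
  (axis_coord (realvec p) (realvec d) 1 (realvec v) = zR (zproj p d v).2).
Proof. by rewrite /axis_coord !vec3E /= !zRB !zRM !zRB. Qed.

Lemma axis_coord_affine (p d : E3) j t a b :
  axis_coord p d j ((1 - t) *: a + t *: b) =
  (1 - t) * axis_coord p d j a + t * axis_coord p d j b.
Proof. by rewrite /axis_coord !mxE; ring. Qed.

(** A clockwise projection is handled by exchanging the two plane coordinates, which changes the
    sign of every cross product. *)
Lemma winds_about_trivial (V : finType) (pos : V -> zvec) (p d : zvec)
    (c : seq V) : uniq c -> winds_about p d (map pos c) ->
  trivial_knot [set of_R3 x | x in polygon (realvec \o pos) c].
Proof.
move=> uc /andP[d0]; rewrite -map_comp !star_map => windc.
apply: (@encircles_trivial _ (realvec p) (realvec d)).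
- exact: polygon_compact.
- by rewrite vec3E zR_eq0.
have ccwE u v : zccw u v = (0 < cross (zR u.1, zR u.2) (zR v.1, zR v.2)).
  by rewrite /cross -!zRM -zRB zR_gt0.
case/orP: windc => windc; [|apply: encircles_swap]; apply: star_encircles => //;
  try exact: axis_coord_affine.
- apply: etrans windc; apply: eq_star => x y /=.
  by rewrite !axis_coord_zproj ccwE.
- apply: etrans windc; apply: eq_star => x y /=.
  by rewrite !axis_coord_zproj ccwE /cross /=; congr (0 < _); ring.
Qed.

End real_certificate.

(** * The straight embedding *)

Section tournament.
Variables (V : finType) (e : rel V).
Hypothesis he : tournament e.

Lemma tournament_asym u v : e u v -> ~~ e v u.
Proof.
case: he => irr tot uv; have [uvE|/tot] := eqVneq u v.
  by move: uv; rewrite uvE (negPf (irr v)).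
by rewrite uv; case: (e v u).
Qed.

Lemma dicycle_size c : dicycle e c -> (2 < size c)%N.
Proof.
case/and3P; case: c => [|x [|y [|z c]]] //= _ _.
  by rewrite andbT (negPf (he.1 x)).
by rewrite andbT => /andP[/tournament_asym/negPf->].
Qed.

End tournament.

Section embedding.
Variables (R : realType) (V : finType) (e : rel V).
Local Notation E3 := 'rV[R]_3.

(** Any numbering would serve, since the certificate covers every cyclic order of three to five
    labels. *)
Definition label (v : V) : nat := enum_rank v.

Lemma label_inj : injective label.
Proof. by move=> u v /val_inj/enum_rank_inj. Qed.

Definition moment_point (v : V) : E3 := realvec R (zvertex (label v)).

Let tau (v : V) : R := (label v)%:R.

Lemma tau_neq u v : u != v -> tau u - tau v != 0.
Proof. by rewrite subr_eq0 eqr_nat (inj_eq label_inj). Qed.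

Lemma zR_nat n : zR R (Z.of_nat n) = n%:R.
Proof. by rewrite /zR pmulrn; congr _%:~R; lia. Qed.

Lemma moment_pointE v :
  moment_point v = vec3 (120 * tau v) (120 * tau v ^+ 2) (120 * tau v ^+ 3).
Proof.
have zD x y : zR R (Z.add x y) = zR R x + zR R y.
  by rewrite /zR -intrD; congr _%:~R; lia.
rewrite /moment_point /realvec /zvertex /zcomb /zmoment; cbn [fst snd].
have z120 : zR R 120 = 120 by [].
have z0 : zR R 0 = 0 by [].
by rewrite !zD !zRM !zR_nat z120 z0 -/(tau v); congr vec3; ring.
Qed.

(* The affine function agreeing with [120 (x - a) (x - b) (x - c)] on the
   moment curve. *)
Let cubic (a b c : R) (x : E3) : R :=
  x 0 2%:R - (a + b + c) * x 0 1 + (a * b + b * c + c * a) * x 0 0 -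
  120 * (a * b * c).

Lemma cubic_moment_point a b c v :
  cubic a b c (moment_point v) = 120 * ((tau v - a) * (tau v - b) * (tau v - c)).
Proof. by rewrite /cubic moment_pointE !vec3E; ring. Qed.

Lemma cubic_affine a b c t x y :
  cubic a b c ((1 - t) *: x + t *: y) =
  (1 - t) * cubic a b c x + t * cubic a b c y.
Proof. by rewrite /cubic !mxE; ring. Qed.

(** The affine function vanishing on the curve at [v], [u'] and [v'] kills the right-hand side and
    leaves only the [u] term on the left, so [u] is one of its roots. The roots may coincide. *)
Lemma segment_endpoint u v u' v' s t : u != v -> s != 1 ->
  (1 - s) *: moment_point u + s *: moment_point v =
    (1 - t) *: moment_point u' + t *: moment_point v' ->
  u = u' \/ u = v'.
Proof.
move=> uv s1 /(congr1 (cubic (tau v) (tau u') (tau v'))).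
rewrite !cubic_affine !cubic_moment_point !subrr !(mul0r, mulr0, addr0).
move/eqP; rewrite !mulf_eq0 subr_eq0 eq_sym (negPf s1) (negPf (tau_neq uv)).
rewrite pnatr_eq0 /=.
have [->|uu] := eqVneq u u'; first by left.
have [->|uv'] := eqVneq u v'; first by right.
by rewrite (negPf (tau_neq uu)) (negPf (tau_neq uv')).
Qed.

Lemma moment_point_inj : injective moment_point.
Proof.
move=> u v uv; apply: contrapT => /eqP nuv.
have : 120 * tau u = 120 * tau v.
  by have := congr1 (fun x : E3 => x 0 0) uv; rewrite !moment_pointE !vec3E.
move/mulfI => /(_ _)/eqP; rewrite pnatr_eq0 -subr_eq0 (negPf (tau_neq nuv)).
by move=> /(_ isT).
Qed.

Hypothesis he : tournament e.

Let straight_arc u v (t : R) : S3 R :=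
  of_R3 ((1 - t) *: moment_point u + t *: moment_point v).

Lemma of_R3_inj : injective (@of_R3 R).
Proof. by move=> x y []. Qed.

Lemma edge_neq u v : e u v -> u != v.
Proof. by move=> uv; apply/eqP => uvE; move: uv; rewrite uvE (negPf (he.1 v)). Qed.

Lemma straight_pt_inj : injective (@of_R3 R \o moment_point).
Proof. exact: inj_comp of_R3_inj moment_point_inj. Qed.

Lemma straight_continuous u v : e u v ->
  {within `[0, 1], continuous (straight_arc u v)}.
Proof.
move=> _; apply: continuous_subspaceT => t.
apply: (@continuous_comp _ _ (S3 R)
  (fun t : R => (1 - t) *: moment_point u + t *: moment_point v) (@of_R3 R) t).
  exact: segment_continuous.
exact: one_point_compactification_some_continuous.
Qed.

Lemma straight0 u v : e u v -> straight_arc u v 0 = of_R3 (moment_point u).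
Proof. by rewrite /straight_arc subr0 scale1r scale0r addr0. Qed.

Lemma straight1 u v : e u v -> straight_arc u v 1 = of_R3 (moment_point v).
Proof. by rewrite /straight_arc subrr scale1r scale0r add0r. Qed.

Lemma straight_pt u v w (t : R) : e u v -> 0 < t < 1 ->
  straight_arc u v t <> of_R3 (moment_point w).
Proof.
move=> /edge_neq uv /andP[t0 t1] /of_R3_inj.
(* The vertex is treated as a degenerate segment. *)
have -> : moment_point w = (1 - 0) *: moment_point w + 0 *: moment_point w.
  by rewrite subr0 scale1r scale0r addr0.
move=> E; have uw : u = w by case: (segment_endpoint uv _ E) => //; rewrite lt_eqF.
have vw : v = w.
  (* Reversing the parametrization makes the other endpoint the first one. *)
  move: E; rewrite addrC -{1}[t](subKr 1) => /segment_endpoint[] //.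
    by rewrite eq_sym.
  by rewrite subr_eq addrC -subr_eq subrr eq_sym gt_eqF.
by move: uv; rewrite uw vw eqxx.
Qed.

Lemma straight_inj u v u' v' (s t : R) : e u v -> e u' v' ->
  0 < s < 1 -> 0 < t < 1 -> straight_arc u v s = straight_arc u' v' t ->
  [/\ u = u', v = v' & s = t].
Proof.
move=> euv euv' /andP[s0 s1] /andP[t0 t1] /of_R3_inj E.
have uv := edge_neq euv.
have uE : u = u' \/ u = v' by apply: (segment_endpoint uv _ E); rewrite lt_eqF.
have vE : v = u' \/ v = v'.
  move: E; rewrite addrC -{1}[s](subKr 1) => /segment_endpoint; apply.
    by rewrite eq_sym.
  by rewrite subr_eq addrC -subr_eq subrr eq_sym gt_eqF.
have [uu vv] : u = u' /\ v = v'.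
  case: uE vE => uE [] vE //.
  - by move: uv; rewrite uE vE eqxx.
  (* Here the two edges would be antiparallel. *)
  - by move: (tournament_asym he euv); rewrite uE vE euv'.
  - by move: uv; rewrite uE vE eqxx.
split=> //; move: E; rewrite -uu -vv => E.
have lin r (x y : E3) : ((1 - r) *: x + r *: y) 0 0 = (1 - r) * x 0 0 + r * y 0 0.
  by rewrite !mxE.
have := congr1 (fun x : E3 => x 0 0) E; rewrite /= !lin !moment_pointE !vec3E.
move=> {}E; apply/eqP; rewrite -subr_eq0.
have : (s - t) * (tau v - tau u) == 0.
  by apply/eqP; apply: (@mulfI _ 120); [rewrite pnatr_eq0 | lra].
by rewrite mulf_eq0 (negPf (tau_neq _)) ?orbF // eq_sym.
Qed.

Lemma straight_tame : tame (range (@of_R3 R \o moment_point) `|`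
  [set straight_arc uv.1 uv.2 t |
     uv in [set uv : V * V | e uv.1 uv.2] & t in `[0, 1]]).
Proof.
exists id; first by split; [|exists id; split] => // x; exact: cvg_id.
(* The diagonal pairs give degenerate segments, which account for the vertices. *)
exists [seq (moment_point uv.1, moment_point uv.2) |
  uv <- enum {: V * V} & (uv.1 == uv.2) || e uv.1 uv.2].
rewrite image_id; apply/seteqP; split.
  move=> _ [[v _ <-]|[[u v] /= uv [t t01 <-]]].
    exists (moment_point v) => //; exists (moment_point v, moment_point v).
      by apply/mapP; exists (v, v) => //; rewrite mem_filter eqxx mem_enum.
    by exists 0; rewrite /= ?in_itv /= ?lexx ?ler01 // subr0 scale1r scale0r addr0.
  exists ((1 - t) *: moment_point u + t *: moment_point v) => //.
  exists (moment_point u, moment_point v); last by exists t.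
  by apply/mapP; exists (u, v) => //; rewrite mem_filter uv orbT mem_enum.
move=> _ [x [_ /mapP[[u v] + ->] [t t01 <-]] <-].
rewrite mem_filter /= => /andP[/orP[/eqP<-|uv] _].
  by left; exists u => //=; rewrite -scalerDl subrK scale1r.
by right; exists (u, v) => //; exists t.
Qed.

Definition straight_embedding : spatial_embedding R e :=
  Build_spatial_embedding straight_pt_inj straight_continuous straight0 straight1
    straight_pt straight_inj straight_tame.

Lemma cycle_image_straight c :
  cycle_image straight_embedding c = [set of_R3 x | x in polygon moment_point c].
Proof.
apply/seteqP; split=> [_ [x xc [t t01 <-]]|_ [_ [x xc [t t01 <-]] <-]].
  exists ((1 - t) *: moment_point x + t *: moment_point (next c x)) => //.
  by exists x => //; exists t.
by exists x => //; exists t.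
Qed.

Hypothesis hV : #|V| = 8%N.

(** Two rotations are involved: one brings the least label to the front, as the enumeration expects,
    and the other is the one at which the certificate found its line. Neither changes the
    polygon. *)
Lemma short_polygon_trivial (c : seq V) : uniq c -> (3 <= size c <= 5)%N ->
  trivial_knot [set of_R3 x | x in polygon moment_point c].
Proof.
move=> uc sc.
have lab8 v : (label v < 8)%N by rewrite -hV ltn_ord.
have [x0 x0c] : exists x, x \in c.
  by case: c sc {uc} => // x c; exists x; rewrite mem_head.
have [x xc xmin] := @arg_minnP _ x0 (mem c) label x0c.
have [n s rotc] := rot_to xc.
have us : uniq (x :: s) by rewrite -rotc rot_uniq.
have ss : (2 <= size s <= 4)%N by move: sc; rewrite -(size_rot n) rotc.
have : has_axis (map label (x :: s)).
  apply: short_cycles_have_axis => //; rewrite ?size_map //.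
    by rewrite -[_ :: _]/(map label (x :: s)) (map_inj_uniq (@label_inj)).
  apply/allP => _ /mapP[y ys ->].
  have yc : y \in c by rewrite -(mem_rot n) rotc inE ys orbT.
  rewrite lab8 andbT ltn_neqAle (xmin y yc) andbT (inj_eq (@label_inj)).
  by apply: contraTneq us => ->; rewrite /= ys.
move=> /hasP[m _ /hasP[l _]]; rewrite -map_rot -map_comp => windm.
rewrite -(polygon_rot _ n uc) rotc -(polygon_rot _ m us).
by apply: winds_about_trivial windm; rewrite rot_uniq.
Qed.

End embedding.

Local Close Scope ring_scope.
Local Close Scope classical_set_scope.

Theorem proposition8p1 (R : realType) (V : finType) (e : rel V)
  (hV : #|V| = 8) (he : tournament e) :
  ~ intrinsically_linked_knotted R 2 1 e.
Proof.
move=> /(_ (straight_embedding R he))[c [dic disj _ [A /card_gt0P[i iA] knotted]]].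
apply: (knotted i iA).
have [j ij] : exists j : 'I_2, i != j.
  by exists (lift i ord0); exact: neq_lift.
have sum8 : (size (c i) + size (c j) <= 8)%N.
  rewrite -size_cat -hV; have /card_uniqP <- : uniq (c i ++ c j).
    by rewrite cat_uniq disj //; case/and3P: (dic i) => _ ->; case/and3P: (dic j).
  exact: max_card.
have sj := dicycle_size he (dic j); have si := dicycle_size he (dic i).
rewrite cycle_image_straight; apply: short_polygon_trivial => //.
  by case/and3P: (dic i).
by rewrite si; lia.
Qed.
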